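(* Let $A$ be an algebra in an arithmetical variety. Then the lattice $\operatorname{Unif} A$ of compatible uniformities on $A$ is distributive.
   Context: A Mal'cev variety is a variety having a ternary term $p$ satisfying $p(x,x,y)=p(y,x,x)=y$. An arithmetical variety is a Mal'cev variety having a ternary term $M$ satisfying the identities $M(x,x,y)=M(x,y,x)=M(y,x,x)=x$. A uniformity on a set $S$ is a filter $\mathcal U$ of reflexive binary relations on $S$ such that $U\in\mathcal U$ implies $U^{-1}\in\mathcal U$, and for every $U\in\mathcal U$ there is $V\in\mathcal U$ with $V\circ V\subseteq U$. A uniformity on the underlying set of an algebra $A$ is compatible if all basic operations of $A$ are uniformly continuous; $\operatorname{Unif} A$ is the complete lattice of compatible uniformities, ordered by reverse inclusion ($\mathcal U_1\le\mathcal U_2$ iff $\mathcal U_2\subseteq\mathcal U_1$). *)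

(* Defs.v *)
From HB Require Import structures.
From mathcomp Require Import all_boot all_order.
From mathcomp Require Import boolp classical_sets filter.

Set Implicit Arguments.
Unset Strict Implicit.
Unset Printing Implicit Defensive.

Local Open Scope classical_set_scope.
Local Open Scope relation_scope.

Record signature := Signature {
  op : Type;
  arity : op -> nat
}.

(* Carriers may be empty. *)
Record algebra (S : signature) := Algebra {
  carrier :> Type;
  interp : forall o : op S, ('I_(arity o) -> carrier) -> carrier
}.
Arguments interp {S} a o _.

Inductive term (S : signature) (X : Type) : Type :=
| Var (x : X)
| App (o : op S) (t : 'I_(arity o) -> term S X).
Arguments Var {S X} x.
Arguments App {S X} o t.

Fixpoint eval (S : signature) (X : Type) (A : algebra S) (v : X -> A)
    (t : term S X) : A :=
  match t with
  | Var x => v x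
  | App o ts => interp A o (fun i => eval v (ts i))
  end.

(* The ternary term operation induced on [A] by [t]. *)
Definition eval3 (S : signature) (A : algebra S) (t : term S 'I_3)
    (x y z : A) : A :=
  eval (tnth [tuple x; y; z]) t.

Definition identity (S : signature) : Type := (term S nat * term S nat)%type.

Definition satisfies (S : signature) (A : algebra S) (e : identity S) : Prop :=
  forall v : nat -> A, eval v e.1 = eval v e.2.

Definition variety (S : signature) (K : set (algebra S)) : Prop :=
  exists E : set (identity S),
    K = [set A | forall e, E e -> satisfies A e].

Definition malcev_variety (S : signature) (K : set (algebra S)) : Prop :=
  variety K /\
  exists p : term S 'I_3, forall B : algebra S, K B ->
    forall x y : B, eval3 p x x y = y /\ eval3 p y x x = y.

Definition arithmetical_variety (S : signature) (K : set (algebra S)) : Prop :=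
  malcev_variety K /\
  exists M : term S 'I_3, forall B : algebra S, K B ->
    forall x y : B,
      [/\ eval3 M x x y = x, eval3 M x y x = x & eval3 M y x x = x].

(* The axioms of the mixin behind [uniformType], for a bare set system: the
   uniformities considered below all live on one type. [Filter] allows the
   empty relation as a member, which reflexivity excludes unless [T] is empty. *)
Record uniformity (T : Type) (E : set_system (T * T)) : Prop := Uniformity {
  uniformity_filter : Filter E;
  uniformity_refl : forall U, E U -> diagonal `<=` U;
  uniformity_inv : forall U, E U -> E U^-1;
  uniformity_split : forall U, E U -> exists2 V, E V & V \; V `<=` U
}.

(* Uniform continuity of an operation of arity [n] from [A ^ n], with the
   product uniformity, to [A]. *)
Definition op_unif_continuous (T : Type) (E : set_system (T * T)) (n : nat)
    (f : ('I_n -> T) -> T) : Prop :=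
  forall U, E U -> exists2 V, E V &
    forall x y : 'I_n -> T, (forall i, V (x i, y i)) -> U (f x, f y).

Definition compatible (S : signature) (A : algebra S)
    (E : set_system (A * A)) : Prop :=
  forall o : op S, op_unif_continuous E (interp A o).

Record Unif (S : signature) (A : algebra S) := MkUnif {
  unif_rel : set_system (A * A);
  unif_uniformity : uniformity unif_rel;
  unif_compatible : compatible unif_rel
}.

Fact unif_display : Order.disp_t. Proof. exact: Order.Disp tt tt. Qed.

Section UnifLattice.
Variables (S : signature) (A : algebra S).
Implicit Types E F G : Unif A.

Lemma unif_eqP E F : unif_rel E = unif_rel F -> E = F.
Proof.
case: E F => [E u c] [F u' c'] /= EF; move: u' c'; rewrite -EF => u' c'.
by rewrite (Prop_irrelevance u u') (Prop_irrelevance c c').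
Qed.

HB.instance Definition _ := gen_eqMixin (Unif A).
HB.instance Definition _ := gen_choiceMixin (Unif A).

(* Reverse inclusion: finer uniformities are smaller. *)
Definition unif_le E F : bool := `[< unif_rel F `<=` unif_rel E >].

Lemma unif_leP E F : reflect (unif_rel F `<=` unif_rel E) (unif_le E F).
Proof. exact: asboolP. Qed.

Lemma unif_le_refl : reflexive unif_le.
Proof. by move=> E; apply/unif_leP. Qed.

Lemma unif_le_anti : antisymmetric unif_le.
Proof.
move=> E F /andP[/unif_leP FE /unif_leP EF].
by apply: unif_eqP; apply/seteqP; split.
Qed.

Lemma unif_le_trans : transitive unif_le.
Proof.
move=> F E G /unif_leP FE /unif_leP GF; apply/unif_leP.
exact: subset_trans GF FE.
Qed.

HB.instance Definition _ := Order.Le_isPOrder.Build unif_display (Unif A)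
  unif_le_refl unif_le_anti unif_le_trans.

(* The uniformity generated by [E] and [F]. *)
Definition meet_rel E F : set_system (A * A) :=
  [set W | exists U V, [/\ unif_rel E U, unif_rel F V & U `&` V `<=` W]].

Lemma meet_uniformity E F : uniformity (meet_rel E F).
Proof.
have [FE rE iE sE] := unif_uniformity E; have [FF rF iF sF] := unif_uniformity F.
split.
- split.
  + by exists setT, setT; split; [exact: filterT|exact: filterT|].
  + move=> P Q [U [V [EU FV UVP]]] [U' [V' [EU' FV' UVQ]]].
    exists (U `&` U'), (V `&` V'); split; [exact: filterI|exact: filterI|].
    by move=> a [[? ?] [? ?]]; split; [apply: UVP|apply: UVQ].
  + move=> P Q PQ [U [V [EU FV UVP]]]; exists U, V; split=> //.
    exact: subset_trans PQ.
- move=> W [U [V [EU FV UVW]]] a da; apply: UVW.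
  by split; [exact: rE da|exact: rF da].
- move=> W [U [V [EU FV UVW]]]; exists U^-1, V^-1; split; [exact: iE|exact: iF|].
  by move=> a [? ?]; apply: UVW.
- move=> W [U [V [EU FV UVW]]].
  have [U' EU' UU] := sE _ EU; have [V' FV' VV] := sF _ FV.
  exists (U' `&` V'); first by exists U', V'; split.
  move=> a [z [? ?] [? ?]]; apply: UVW.
  by split; [apply: UU; exists z|apply: VV; exists z].
Qed.

Lemma meet_compatible E F : compatible (meet_rel E F).
Proof.
move=> o W [U [V [EU FV UVW]]].
have [U' EU' cU] := @unif_compatible _ _ E o _ EU.
have [V' FV' cV] := @unif_compatible _ _ F o _ FV.
exists (U' `&` V'); first by exists U', V'; split.
move=> x y xy; apply: UVW.
by split; [apply: cU => i; case: (xy i)|apply: cV => i; case: (xy i)].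
Qed.

Definition unif_meet E F : Unif A :=
  MkUnif (meet_uniformity E F) (@meet_compatible E F).

Lemma unif_meetP G E F : (G <= unif_meet E F)%O = (G <= E)%O && (G <= F)%O.
Proof.
have [FG _ _ _] := unif_uniformity G.
have [FE _ _ _] := unif_uniformity E; have [FF _ _ _] := unif_uniformity F.
apply/idP/andP => [/unif_leP h|[/unif_leP hE /unif_leP hF]].
  split; apply/unif_leP => U EU; apply: h.
    by exists U, setT; split; [|exact: filterT|move=> a []].
  by exists setT, U; split; [exact: filterT| |move=> a []].
apply/unif_leP => W [U [V [EU FV UVW]]].
by apply: filterS UVW _; apply: filterI; [exact: hE|exact: hF].
Qed.

(* The largest compatible uniformity contained in [E] and [F]; the plain
   intersection of [E] and [F] need not be a uniformity. *)
Definition join_rel E F : set_system (A * A) :=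
  [set W | exists G, [/\ (E <= G)%O, (F <= G)%O & unif_rel G W]].

Lemma trivial_uniformity : uniformity [set W : set (A * A) | W = setT].
Proof.
split.
- split=> //.
  + by move=> P Q /= -> ->; rewrite setIT.
  + by move=> P Q PQ /= P1; apply/seteqP; split=> // a _; apply: PQ; rewrite P1.
- by move=> U /= -> a.
- by move=> U /= ->; apply/seteqP; split.
- by move=> U /= ->; exists setT.
Qed.

Lemma trivial_compatible : compatible [set W : set (A * A) | W = setT].
Proof. by move=> o U /= ->; exists setT. Qed.

Definition unif_trivial : Unif A :=
  MkUnif trivial_uniformity trivial_compatible.

Lemma unif_le_trivial E : (E <= unif_trivial)%O.
Proof.
have [FE _ _ _] := unif_uniformity E.
by apply/unif_leP => U /= ->; exact: filterT.
Qed.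

Lemma join_uniformity E F : uniformity (join_rel E F).
Proof.
split.
- split.
  + exists unif_trivial; split; [exact: unif_le_trivial|exact: unif_le_trivial|by []].
  + move=> P Q [G [EG FG GP]] [H [EH FH HQ]].
    exists (unif_meet G H); rewrite !unif_meetP EG FG EH FH.
    split=> //.
    by exists P, Q; split.
  + move=> P Q PQ [G [EG FG GP]]; exists G; split=> //.
    by have [FiG _ _ _] := unif_uniformity G; exact: filterS PQ GP.
- by move=> W [G [_ _ GW]]; exact: uniformity_refl (unif_uniformity G) _ GW.
- move=> W [G [EG FG GW]]; exists G; split=> //.
  exact: uniformity_inv (unif_uniformity G) _ GW.
- move=> W [G [EG FG GW]].
  have [V GV VW] := uniformity_split (unif_uniformity G) GW.
  by exists V => //; exists G.
Qed.

Lemma join_compatible E F : compatible (join_rel E F).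
Proof.
move=> o W [G [EG FG GW]].
have [V GV VW] := @unif_compatible _ _ G o _ GW.
by exists V => //; exists G.
Qed.

Definition unif_join E F : Unif A :=
  MkUnif (join_uniformity E F) (@join_compatible E F).

Lemma unif_joinP E F G : (unif_join E F <= G)%O = (E <= G)%O && (F <= G)%O.
Proof.
apply/idP/andP => [/unif_leP h|[EG FG]].
  by split; apply/unif_leP => W /h [H [/unif_leP EH /unif_leP FH HW]];
    [exact: EH|exact: FH].
by apply/unif_leP => W GW; exists G.
Qed.

HB.instance Definition _ := Order.POrder_MeetJoin_isLattice.Build
  unif_display (Unif A) unif_meetP unif_joinP.

End UnifLattice.

(* Main.v *)
Require Import Defs.
From HB Require Import structures.
From mathcomp Require Import all_boot all_order.
From mathcomp Require Import boolp classical_sets filter.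

(** For compatible uniformities in a Mal'cev variety, [x W y V z] gives
    [x V p(x,y,z) W z] up to shrinking entourages, so the relations
    [w \; v] (first [v], then [w])
    form a base of a compatible uniformity, which is [V `|` W].  If moreover
    [x U z] and [x V y W z], then [M(x,y,z)] is [U]-close to both [x] and [z],
    [V]-close to [x] and [W]-close to [z]; hence an entourage of
    [(U `&` V) `|` (U `&` W)] contains one of the form [u `&` (w \; v)]. *)

Set Implicit Arguments.
Unset Strict Implicit.
Unset Printing Implicit Defensive.

Import Order.LTheory.

Local Open Scope classical_set_scope.
Local Open Scope relation_scope.

(** Induction on [t]: compatibility covers each basic operation, and arities are finite, so the
    entourages found for the subterms have an entourage as intersection. *)
Lemma eval_unif_continuous (S : signature) (A : algebra S) (n : nat)
    (t : term S 'I_n) (E : Unif A) :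
  op_unif_continuous (unif_rel E) (fun x : 'I_n -> A => eval x t).
Proof.
have [FE _ _ _] := unif_uniformity E.
elim: t => [i|o ts IH] U EU; first by exists U => // x y; apply.
have [V EV oV] := @unif_compatible _ _ E o _ EU.
have /choice[W hW] : forall i, exists W, unif_rel E W /\ forall x y : 'I_n -> A,
    (forall j, W (x j, y j)) -> V (eval x (ts i), eval y (ts i)).
  by move=> i; have [W EW hW] := IH i _ EV; exists W.
exists [set a | forall i, W i a]; first exact: filter_forall (fun i => (hW i).1).
by move=> x y xy; apply: oV => i; apply: (hW i).2 => j; apply: xy.
Qed.

Lemma eval3_unif_continuous (S : signature) (A : algebra S) (t : term S 'I_3)
    (E : Unif A) (U : set (A * A)) : unif_rel E U ->
  exists2 V, unif_rel E V & forall x y z x' y' z',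
    V (x, x') -> V (y, y') -> V (z, z') -> U (eval3 t x y z, eval3 t x' y' z').
Proof.
move=> EU; have [V EV tV] := eval_unif_continuous t EU.
exists V => // x y z x' y' z' Vx Vy Vz; apply: tV.
by case=> [[|[|[|i]]] ?].
Qed.

Section Malcev.
Variables (S : signature) (A : algebra S) (p : term S 'I_3).
Hypothesis pP : forall x y : A, eval3 p x x y = y /\ eval3 p y x x = y.
Implicit Types E F : Unif A.

Lemma malcev_permute E F (U V : set (A * A)) : unif_rel E U -> unif_rel F V ->
  exists U' V', [/\ unif_rel E U', unif_rel F V' & U' \; V' `<=` V \; U].
Proof.
move=> EU FV.
have [_ rE _ _] := unif_uniformity E; have [_ rF _ _] := unif_uniformity F.
have [U' EU' pU] := eval3_unif_continuous p EU.
have [V' FV' pV] := eval3_unif_continuous p FV.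
have U'xx x : U' (x, x) by exact: rE.
have V'xx x : V' (x, x) by exact: rF.
exists U', V'; split=> // -[x z] [y /= V'xy U'yz].
(* Compare with [p(x,y,y) = x], moving only the third argument, and with [p(y,y,z) = z], moving only
   the first. *)
exists (eval3 p x y z) => /=.
- by rewrite -[X in U (X, _)](pP y x).2; apply: pU.
- by rewrite -[X in V (_, X)](pP y z).1; apply: pV.
Qed.

Definition comp_rel E F : set_system (A * A) :=
  [set T | exists U V, [/\ unif_rel E U, unif_rel F V & V \; U `<=` T]].

Lemma comp_uniformity E F : uniformity (comp_rel E F).
Proof.
have [FE rE iE sE] := unif_uniformity E; have [FF rF iF sF] := unif_uniformity F.
split.
- split.
  + by exists setT, setT; split; [exact: filterT|exact: filterT|].
  + move=> P Q [U [V [EU FV UVP]]] [U' [V' [EU' FV' UVQ]]].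
    exists (U `&` U'), (V `&` V'); split; [exact: filterI|exact: filterI|].
    by move=> a [z [? ?] [? ?]]; split; [apply: UVP|apply: UVQ]; exists z.
  + move=> P Q PQ [U [V [EU FV UVP]]]; exists U, V; split=> //.
    exact: subset_trans PQ.
- move=> T [U [V [EU FV UVT]]] [x y] xy; apply: UVT.
  by exists y; [exact: rE xy|exact: rF].
- move=> T [U [V [EU FV UVT]]].
  (* Inversion reverses the order of composition; permuting restores it. *)
  have [U1 [V1 [EU1 FV1 VU1]]] := malcev_permute EU FV.
  exists U1^-1, V1^-1; split; [exact: iE|exact: iF|].
  by move=> [x y] [z /= xz zy]; apply/UVT/VU1; exists z.
- move=> T [U [V [EU FV UVT]]].
  have [U1 EU1 UU] := sE _ EU; have [V1 FV1 VV] := sF _ FV.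
  have [U2 [V2 [EU2 FV2 VU]]] := malcev_permute EU1 FV1.
  (* A double step is [x U1 a V2 z U2 b V1 y]; permuting the middle pair gives
     [x U1 a U1 c V1 b V1 y], which [UU] and [VV] contract. *)
  exists ((V1 `&` V2) \; (U1 `&` U2)).
    by exists (U1 `&` U2), (V1 `&` V2); split; [exact: filterI|exact: filterI|].
  move=> [x y] [z [a /= [xa _] [_ az]] [b /= [_ zb] [by_ _]]].
  have [c /= ac cb] : (V1 \; U1) (a, b) by apply: VU; exists z.
  by apply: UVT; exists c; [apply: UU; exists a|apply: VV; exists b].
Qed.

Lemma comp_compatible E F : compatible (comp_rel E F).
Proof.
move=> o T [U [V [EU FV UVT]]].
have [U' EU' oU] := @unif_compatible _ _ E o _ EU.
have [V' FV' oV] := @unif_compatible _ _ F o _ FV.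
exists (V' \; U'); first by exists U', V'; split.
move=> x y xy.
(* Intermediate points are chosen coordinatewise; the operation applied to them is the intermediate
   point for the values. *)
have /choice[z xzy] : forall i, exists z, U' (x i, z) /\ V' (z, y i).
  by move=> i; have [z ? ?] := xy i; exists z.
by apply: UVT; exists (interp A o z); [apply: oU|apply: oV] => i; case: (xzy i).
Qed.

Lemma malcev_join E F : unif_rel (E `|` F)%O = comp_rel E F.
Proof.
have [FE rE _ _] := unif_uniformity E; have [FF rF _ _] := unif_uniformity F.
apply/seteqP; split => [T [G [/unif_leP EG /unif_leP FG GT]]|T [U [V [EU FV UVT]]]].
  (* [G] is contained in both [E] and [F], so half of [T] serves as entourage of each. *)
  have [T' GT' TT] := uniformity_split (unif_uniformity G) GT.
  by exists T', T'; split; [exact: EG|exact: FG|].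
(* By reflexivity a composite contains both its factors, so this uniformity lies above [E] and
   [F]. *)
exists (MkUnif (comp_uniformity E F) (@comp_compatible E F)); split.
- apply/unif_leP => P [U' [V' [EU' FV' UVP]]]; apply: filterS EU' => -[x y] xy.
  by apply: UVP; exists y => //; exact: rF.
- apply/unif_leP => P [U' [V' [EU' FV' UVP]]]; apply: filterS FV' => -[x y] xy.
  by apply: UVP; exists x => //; exact: rE.
- by exists U, V; split.
Qed.

End Malcev.

Lemma majority_unif (S : signature) (A : algebra S) (M : term S 'I_3)
    (MP : forall x y : A,
      [/\ eval3 M x x y = x, eval3 M x y x = x & eval3 M y x x = x])
    (E F G : Unif A) (P Q : set (A * A)) :
  unif_rel (E `&` F)%O P -> unif_rel (E `&` G)%O Q ->
  exists U V W, [/\ unif_rel E U, unif_rel F V, unif_rel G W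
    & U `&` (W \; V) `<=` Q \; P].
Proof.
have [FE rE _ _] := unif_uniformity E.
have [_ rF _ _] := unif_uniformity F; have [_ rG _ _] := unif_uniformity G.
move=> [U1 [V [EU1 FV UVP]]] [U2 [W [EU2 GW UWQ]]].
(* [U1] and [U2] both belong to [E], so one [U'] controls both. *)
have [U' EU' MU] := eval3_unif_continuous M (filterI EU1 EU2).
have [V' FV' MV] := eval3_unif_continuous M FV.
have [W' GW' MW] := eval3_unif_continuous M GW.
have U'xx x : U' (x, x) by exact: rE.
have V'xx x : V' (x, x) by exact: rF.
have W'xx x : W' (x, x) by exact: rG.
exists U', V', W'; split=> // -[x z] [U'xz [y /= V'xy W'yz]].
have [Mxxz _ _] := MP x z; have [_ _ Mxzz] := MP z x.
have [_ Mxyx _] := MP x y; have [_ Mzyz _] := MP z y.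
(* Each of the four closeness relations moves a single argument away from one of [M(x,y,x)],
   [M(x,x,z)], [M(z,y,z)], [M(x,z,z)]. *)
exists (eval3 M x y z) => /=.
- apply: UVP; split.
  + by rewrite -[X in U1 (X, _)]Mxyx; apply: (MU _ _ _ _ _ _ _ _ _).1.
  + by rewrite -[X in V (X, _)]Mxxz; apply: MV.
- apply: UWQ; split.
  + by rewrite -[X in U2 (_, X)]Mzyz; apply: (MU _ _ _ _ _ _ _ _ _).2.
  + by rewrite -[X in W (_, X)]Mxzz; apply: MW.
Qed.

Theorem theorem6p5 (S : signature) (K : set (algebra S)) (A : algebra S)
    (hK : arithmetical_variety K) (hA : K A) :
  forall U V W : Unif A,
    (U `&` (V `|` W))%O = ((U `&` V) `|` (U `&` W))%O.
Proof.
move=> E F G; have [[_ [p /(_ _ hA) pP]] [M /(_ _ hA) MP]] := hK.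
apply: le_anti; apply/andP; split; last first.
  (* This inequality holds in every lattice. *)
  rewrite leUx !leI2 //.
    exact: leUr.
  exact: leUl.
(* The order is reverse inclusion: every entourage of the right-hand side must be one of the
   left-hand side. *)
apply/unif_leP => T; rewrite (malcev_join pP (E `&` F)%O) => -[P [Q [EFP EGQ PQT]]].
have [U [V [W [EU FV GW UVWT]]]] := majority_unif MP EFP EGQ.
exists U, (W \; V); split=> //; last exact: subset_trans PQT.
by change (unif_rel (F `|` G)%O (W \; V)); rewrite (malcev_join pP); exists V, W; split.
Qed.
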